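(* Let $E$ be a unital truncated vector lattice, and let $E\oplus\mathbb{R}$ be its Alexandroff unitization. Then $E$ is Dedekind complete if and only if $E\oplus\mathbb{R}$ is Dedekind complete.
   Context: A truncation on a (real) Riesz space (vector lattice) $E$ is a map $x\mapsto\bar{x}$ from $E^{+}$ to $E^{+}$ such that for all $a,b\in E^{+}$: $(\tau_1)$ $a\wedge\bar{b}\leq\bar{a}\leq a$; $(\tau_2)$ $\bar{a}=0$ implies $a=0$. A truncated vector lattice (truncated Riesz space) is a Riesz space $E$ equipped with a truncation. It is called unital if there exists $u\in E^{+}$ (the truncation unit) such that $\bar{x}=x\wedge u$ for all $x\in E^{+}$. The set of fixed points is $\bar{E}=\{x\in E:\overline{|x|}=|x|\}$. The (Alexandroff) unitization $E\oplus\mathbb{R}=\{x+\lambda: x\in E,\lambda\in\mathbb{R}\}$ is the vector space $E\times\mathbb{R}$ (with $E$ identified with $E\times\{0\}$ and $\mathbb{R}$ with $\{0\}\times\mathbb{R}$, so $1=(0,1)$), ordered by the positive cone $(E\oplus\mathbb{R})^{+}=E^{+}\cup\{x+\lambda: x\in E,\ \lambda\in\mathbb{R},\ \lambda>0,\ \tfrac{1}{\lambda}x^{-}\in\bar{E}\}$. It is known that $E\oplus\mathbb{R}$ is a Riesz space, that $E$ is a vector sublattice (indeed a maximal ideal) of it, and that $\bar{x}=x\wedge 1$ for all $x\in E^{+}$. This space is used whether or not $E$ is unital. A Riesz space is Dedekind complete if every nonempty subset that is bounded above has a supremum. *)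

(* Defs.v *)
From HB Require Import structures.
From mathcomp Require Import all_boot all_order all_algebra.
From mathcomp Require Import boolp classical_sets reals.
Set Implicit Arguments.
Unset Strict Implicit.
Unset Printing Implicit Defensive.
Import Order.TTheory GRing.Theory Num.Theory.
Local Open Scope order_scope.
Local Open Scope ring_scope.

(* A structure inheriting from both Order.Lattice and GRing.Zmodule cannot be *)
(* declared downstream of Num.RealDomain, so the lattice operations are mixin *)
(* fields; the Order.Lattice instance is declared just after.                 *)
HB.mixin Record isRiesz (R : realType) E
    of GRing.Lmodule R E & Order.POrder ring_display E := {
  riesz_meet : E -> E -> E ;
  riesz_meetP : forall x y z : E, (x <= riesz_meet y z) = (x <= y) && (x <= z) ;
  riesz_join : E -> E -> E ;
  riesz_joinP : forall x y z : E, (riesz_join x y <= z) = (x <= z) && (y <= z) ;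
  riesz_leD : forall z x y : E, x <= y -> x + z <= y + z ;
  riesz_scale_ge0 : forall (a : R) (x : E), 0 <= a -> 0 <= x -> 0 <= a *: x
}.

#[short(type="rieszType")]
HB.structure Definition Riesz (R : realType) :=
  { E of GRing.Lmodule R E & Order.POrder ring_display E & isRiesz R E }.

HB.instance Definition _ (R : realType) (E : rieszType R) :=
  Order.POrder_MeetJoin_isLattice.Build ring_display (Riesz.sort E)
    (@riesz_meetP R E) (@riesz_joinP R E).

Definition dedekind_complete (R : realType) (E : rieszType R) : Prop :=
  forall A : set E, has_sup A -> exists s, supremums A s.

Section Riesz_theory.
Variables (R : realType) (E : rieszType R).
Implicit Types (x y z : E) (a : R).

Definition rabs x : E := x `|` - x.
Definition rpos x : E := x `|` 0.
Definition rneg x : E := (- x) `|` 0.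

Lemma riesz_leDr z x y : (x + z <= y + z) = (x <= y).
Proof.
apply/idP/idP => [h|]; last exact: riesz_leD.
by rewrite -(addrK z x) -(addrK z y) riesz_leD.
Qed.

Lemma riesz_leDl z x y : (z + x <= z + y) = (x <= y).
Proof. by rewrite ![z + _]addrC riesz_leDr. Qed.

Lemma riesz_le_add x y z t : x <= y -> z <= t -> x + z <= y + t.
Proof.
by move=> xy zt; apply: (@le_trans _ _ (y + z)); rewrite ?riesz_leDr ?riesz_leDl.
Qed.

Lemma riesz_subr_ge0 x y : (0 <= y - x) = (x <= y).
Proof. by rewrite -(riesz_leDr x 0) add0r subrK. Qed.

Lemma riesz_le_subl x y z : (x - y <= z) = (x <= z + y).
Proof. by rewrite -(riesz_leDr y (x - y)) subrK. Qed.

Lemma riesz_opp_le x y : (- x <= - y) = (y <= x).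
Proof. by rewrite -(riesz_subr_ge0 (- x)) opprK addrC riesz_subr_ge0. Qed.

Lemma riesz_le_scale a x y : 0 <= a -> x <= y -> a *: x <= a *: y.
Proof.
move=> a0 xy.
by rewrite -riesz_subr_ge0 -scalerBr riesz_scale_ge0// riesz_subr_ge0.
Qed.

Lemma rabs_id x : 0 <= x -> rabs x = x.
Proof.
move=> x0; apply: join_l; apply: (le_trans _ x0).
by rewrite -[X in _ <= X]oppr0 riesz_opp_le.
Qed.

Lemma rpos_ge0 x : 0 <= rpos x. Proof. exact: leUr. Qed.
Lemma rneg_ge0 x : 0 <= rneg x. Proof. exact: leUr. Qed.

Lemma rposE x : rpos x = x + rneg x.
Proof.
apply/le_anti/andP; split.
  rewrite leUx -{1}[x]addr0 riesz_leDl rneg_ge0 /=.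
  by rewrite -[X in X <= _](subrr x) riesz_leDl leUl.
suff : rneg x <= rpos x - x by move/(riesz_leD x); rewrite subrK addrC.
by rewrite leUx riesz_subr_ge0 leUl andbT -[X in X <= _]add0r riesz_leDr rpos_ge0.
Qed.

End Riesz_theory.

(* A truncation is a map from the positive cone to itself; it is encoded as a *)
(* total function whose values outside the cone are unconstrained and unused. *)
Record truncation (R : realType) (E : rieszType R) := Truncation {
  trunc :> E -> E ;
  trunc_ge0 : forall a : E, 0 <= a -> 0 <= trunc a ;
  trunc_tau1 : forall a b : E, 0 <= a -> 0 <= b ->
    a `&` trunc b <= trunc a <= a ;
  trunc_tau2 : forall a : E, 0 <= a -> trunc a = 0 -> a = 0
}.

Section Truncation_defs.
Variables (R : realType) (E : rieszType R) (tau : truncation E).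

Definition unital_truncation : Prop :=
  exists2 u : E, 0 <= u & forall x : E, 0 <= x -> tau x = x `&` u.

Definition trunc_fixed (x : E) : bool := tau (rabs x) == rabs x.

(* The pair (x, l) stands for x + l.  The order depends on the truncation,    *)
(* which is therefore a parameter of the type.                                *)
Definition unitization of truncation E : Type := (E * R^o)%type.

End Truncation_defs.

HB.instance Definition _ (R : realType) (E : rieszType R) (tau : truncation E) :=
  GRing.Lmodule.copy (unitization tau) (E * R^o)%type.

Section Unitization_order.
Variables (R : realType) (E : rieszType R) (tau : truncation E).

Definition unitization_cone (z : unitization tau) : bool :=
  ((z.2 == 0) && (0 <= z.1))
  || ((0 < z.2) && trunc_fixed tau (z.2^-1 *: rneg z.1)).

Definition unitization_le (z w : unitization tau) : bool :=
  unitization_cone (w - z).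

End Unitization_order.


Section Truncation_theory.
Variables (R : realType) (E : rieszType R) (tau : truncation E).
Implicit Types (x y g h : E) (l m n : R).

Let fixedp g := 0 <= g /\ tau g = g.

Lemma fixedp_trunc x : 0 <= x -> fixedp (tau x).
Proof.
move=> x0; have t0 := trunc_ge0 tau x0; split => //.
have /andP[h1 h2] := trunc_tau1 tau t0 x0.
by apply/le_anti/andP; split => //; move: h1; rewrite meetxx.
Qed.

Lemma fixedp_le x g : 0 <= x -> x <= g -> fixedp g -> fixedp x.
Proof.
move=> x0 xg [g0 gE]; split => //.
have /andP[h1 h2] := trunc_tau1 tau x0 g0.
by apply/le_anti/andP; split => //; move: h1; rewrite gE meet_l.
Qed.

Lemma fixedp_join g h : fixedp g -> fixedp h -> fixedp (g `|` h).
Proof.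
move=> [g0 gE] [h0 hE]; set c := g `|` h.
have c0 : 0 <= c by apply: (le_trans g0); exact: leUl.
split => //; have /andP[g1 c1] := trunc_tau1 tau c0 g0.
have /andP[h1 _] := trunc_tau1 tau c0 h0.
apply/le_anti/andP; split => //.
rewrite {1}/c leUx; move: g1 h1; rewrite gE hE.
by rewrite meet_r ?leUl// meet_r ?leUr// => -> ->.
Qed.

Lemma fixedpP x : 0 <= x -> reflect (fixedp x) (trunc_fixed tau x).
Proof.
by move=> x0; rewrite /trunc_fixed rabs_id//; apply: (iffP eqP) => [xE|[_ ->]].
Qed.

Lemma unitization_coneP (z : unitization tau) :
  reflect (0 <= z.2 /\ exists2 g, fixedp g & - z.1 <= z.2 *: g)
          (unitization_cone z).
Proof.
have fix0 : fixedp 0.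
  split => //; apply/le_anti/andP; split; last exact: trunc_ge0.
  by have /andP[] := trunc_tau1 tau (lexx 0) (lexx 0).
case: z => x l; rewrite /unitization_cone /=; apply: (iffP orP).
  case=> [/andP[/eqP -> x0]|/andP[l0 xf]].
    split=> //; exists 0 => //.
    by rewrite scaler0 -[X in _ <= X]oppr0 riesz_opp_le.
  split; first exact: ltW.
  have p0 : 0 <= l^-1 *: rneg x.
    by rewrite riesz_scale_ge0 ?rneg_ge0// invr_ge0 ltW.
  exists (l^-1 *: rneg x); first exact/fixedpP.
  by rewrite scalerA divff ?gt_eqF// scale1r leUl.
move=> [l0 [g fg xg]]; have [l00|lneq0] := eqVneq l 0.
  left; move: xg; rewrite l00 scale0r -[X in _ <= X]oppr0 riesz_opp_le => -> //.
have {lneq0}l0' : 0 < l by rewrite lt_def lneq0.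
right; rewrite l0' /=.
have p0 : 0 <= l^-1 *: rneg x.
  by rewrite riesz_scale_ge0 ?rneg_ge0// invr_ge0.
apply/fixedpP => //; apply: (fixedp_le p0 _ fg).
have -> : g = l^-1 *: (l *: g) by rewrite scalerA mulVf ?gt_eqF// scale1r.
rewrite riesz_le_scale ?invr_ge0// leUx xg riesz_scale_ge0//.
by case: fg.
Qed.

Lemma unitization_coneD (z w : unitization tau) :
  unitization_cone z -> unitization_cone w -> unitization_cone (z + w).
Proof.
move=> /unitization_coneP[z0 [g fg zg]] /unitization_coneP[w0 [h fh wh]].
apply/unitization_coneP; split; first exact: addr_ge0.
exists (g `|` h); first exact: fixedp_join.
rewrite /= opprD scalerDl; apply: riesz_le_add.
  by apply: (le_trans zg); rewrite riesz_le_scale// leUl.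
by apply: (le_trans wh); rewrite riesz_le_scale// leUr.
Qed.

Lemma unitization_coneZ l (z : unitization tau) :
  0 <= l -> unitization_cone z -> unitization_cone (l *: z).
Proof.
move=> l0 /unitization_coneP[z0 [g fg zg]].
apply/unitization_coneP; split; first exact: mulr_ge0.
by exists g => //=; rewrite -scalerN -scalerA riesz_le_scale.
Qed.

Lemma unitization_cone0 : unitization_cone (0 : unitization tau).
Proof. by rewrite /unitization_cone /= eqxx lexx. Qed.

Lemma unitization_le_refl : reflexive (@unitization_le R E tau).
Proof. by move=> z; rewrite /unitization_le subrr unitization_cone0. Qed.

Lemma unitization_le_anti : antisymmetric (@unitization_le R E tau).
Proof.
move=> [x l] [y m] /andP[] /unitization_coneP[/= ml [g _]] + .
move=> + /unitization_coneP[/= lm [h _]].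
have -> : l = m by apply/le_anti; rewrite -subr_ge0 ml -subr_ge0 lm.
rewrite subrr !scale0r !opprB -[X in _ <= X -> _](subrr y) riesz_leDr.
by rewrite -[X in _ -> _ <= X -> _](subrr x) riesz_leDr => xy yx;
  congr (_, _); apply/le_anti; rewrite xy.
Qed.

Lemma unitization_le_trans : transitive (@unitization_le R E tau).
Proof.
move=> w z t; rewrite /unitization_le => zw wt.
by rewrite -(subrK w t) -addrA unitization_coneD.
Qed.

End Truncation_theory.

HB.instance Definition _ (R : realType) (E : rieszType R) (tau : truncation E) :=
  Order.Le_isPOrder.Build ring_display (unitization tau)
    (@unitization_le_refl R E tau) (@unitization_le_anti R E tau)
    (@unitization_le_trans R E tau).

Section Unitization_lattice.
Variables (R : realType) (E : rieszType R) (tau : truncation E).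
Implicit Types (x y g h : E) (l m n : R) (z w t : unitization tau).

Let fixedp g := 0 <= g /\ tau g = g.

Lemma unitization_leE z w : (z <= w) = unitization_cone (w - z).
Proof. by []. Qed.

Lemma unitization_ge0 z : (0 <= z) = unitization_cone z.
Proof. by rewrite unitization_leE subr0. Qed.

Lemma unitization_leP z w :
  reflect (z.2 <= w.2 /\ exists2 g, fixedp g & z.1 <= w.1 + (w.2 - z.2) *: g)
          (z <= w).
Proof.
rewrite unitization_leE; apply: (iffP (unitization_coneP _)) => /=.
  rewrite subr_ge0 => -[zw [g fg h]]; split => //; exists g => //.
  by rewrite addrC -riesz_le_subl -opprB.
move=> [zw [g fg h]]; rewrite subr_ge0; split => //; exists g => //.
by rewrite opprB riesz_le_subl addrC.
Qed.

Lemma unitization_leD t z w : z <= w -> z + t <= w + t.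
Proof. by rewrite !unitization_leE opprD addrACA subrr addr0. Qed.

Lemma unitization_leDr t z w : (z + t <= w + t) = (z <= w).
Proof. by rewrite !unitization_leE opprD addrACA subrr addr0. Qed.

Lemma unitization_scale_ge0 (a : R) z : 0 <= a -> 0 <= z -> 0 <= a *: z.
Proof. by rewrite !unitization_ge0; exact: unitization_coneZ. Qed.

Definition unitization_in x l : unitization tau := (x, l).

(* This is [x /\ m] for [0 <= x] and [0 <= m], see [le_unitization_cut].      *)
Definition unitization_cut m x : E := m *: tau (m^-1 *: x).

Lemma le_unitization_cut m x z : 0 <= m -> 0 <= x ->
  (z <= unitization_in (unitization_cut m x) 0) =
  (z <= unitization_in x 0) && (z <= unitization_in 0 m).
Proof.
move=> m0 x0.
have mx0 : 0 <= m^-1 *: x by rewrite riesz_scale_ge0 ?invr_ge0.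
apply/idP/andP => [zc|[]].
  have tx : tau (m^-1 *: x) <= m^-1 *: x.
    by have /andP[] := trunc_tau1 tau mx0 mx0.
  have ft := fixedp_trunc tau mx0.
  split; apply: (le_trans zc); apply/unitization_leP; rewrite /= ?subrr ?subr0.
    split => //; exists (tau (m^-1 *: x)) => //; rewrite scale0r addr0.
    have [mE|mN0] := eqVneq m 0; first by rewrite /unitization_cut mE scale0r.
    rewrite /unitization_cut; apply: (le_trans (riesz_le_scale m0 tx)).
    by rewrite scalerA divff// scale1r.
  by split => //; exists (tau (m^-1 *: x)) => //; rewrite add0r.
move=> /unitization_leP[/= n0 [g fg zg]] /unitization_leP[/= nm [h fh zh]].
apply/unitization_leP => /=; split => //; exists (g `|` h).
  exact: fixedp_join.
set n := 0 - z.2 in zg *; set k := g `|` h.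
have fk : fixedp k by exact: fixedp_join.
have nn0 : 0 <= n by rewrite subr_ge0.
rewrite -riesz_le_subl.
have h1 : z.1 - n *: k <= x.
  by rewrite riesz_le_subl (le_trans zg)// riesz_leDl riesz_le_scale// leUl.
have h2 : z.1 - n *: k <= m *: k.
  rewrite riesz_le_subl -scalerDl (le_trans zh)// add0r /n sub0r.
  by rewrite riesz_le_scale ?leUr// subr_ge0.
have [mE|mN0] := eqVneq m 0.
  by rewrite /unitization_cut mE scale0r; move: h2; rewrite mE scale0r.
have {}m0 : 0 < m by rewrite lt_def mN0.
have -> : z.1 - n *: k = m *: (m^-1 *: (z.1 - n *: k)).
  by rewrite scalerA divff// scale1r.
apply: riesz_le_scale; first exact: ltW.
have /andP[+ _] := trunc_tau1 tau mx0 fk.1.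
apply: le_trans; rewrite lexI fk.2.
have mV0 : 0 <= m^-1 by rewrite invr_ge0 ltW.
rewrite riesz_le_scale//=.
have kE : m^-1 *: (m *: k) = k by rewrite scalerA mulVf// scale1r.
by rewrite -[X in _ <= X]kE riesz_le_scale.
Qed.

Lemma rpos_unitization_le x z :
  (unitization_in (rpos x) 0 <= z) = (0 <= z) && (unitization_in x 0 <= z).
Proof.
apply/idP/andP => [xz|[]].
  split; apply: le_trans xz; apply/unitization_leP; rewrite /= subrr;
  split => //; exists (tau 0); rewrite ?scale0r ?addr0 ?rpos_ge0 ?leUl//;
  exact: fixedp_trunc.
move=> /unitization_leP[/= z0 [g fg zg]] /unitization_leP[/= _ [h fh zh]].
apply/unitization_leP; split => //; exists (g `|` h) => /=.
  exact: fixedp_join.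
rewrite leUx (le_trans zh) ?(le_trans zg)// riesz_leDl riesz_le_scale ?leUl ?leUr//;
by rewrite subr_ge0.
Qed.

Definition unitization_pos z : unitization tau :=
  if 0 < z.2 then unitization_in (rpos z.1 - unitization_cut z.2 (rneg z.1)) z.2
  else unitization_in (rpos z.1 - unitization_cut (- z.2) (rpos z.1)) 0.

Lemma unitization_sub_le z w t : (z - w <= t) = (z - t <= w).
Proof. by rewrite !unitization_leE !opprB !addrA [t + w]addrC. Qed.

Lemma unitization_posP z w : (unitization_pos z <= w) = (0 <= w) && (z <= w).
Proof.
case: z => x l; rewrite /unitization_pos /=; case: ltP => l0.
  have -> : unitization_in (rpos x - unitization_cut l (rneg x)) l =
      unitization_in (rpos x) l - unitization_in (unitization_cut l (rneg x)) 0.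
    by rewrite /unitization_in; congr pair; rewrite /= subr0.
  have l0W := ltW l0.
  rewrite unitization_sub_le le_unitization_cut ?rneg_ge0//.
  rewrite 2!(unitization_sub_le _ w).
  have -> : unitization_in (rpos x) l - unitization_in (rneg x) 0 = (x, l).
    by rewrite /unitization_in; congr pair; rewrite /= ?subr0// rposE addrK.
  have -> : unitization_in (rpos x) l - unitization_in 0 l =
      unitization_in (rpos x) 0.
    by rewrite /unitization_in; congr pair; rewrite /= ?subr0// subrr.
  rewrite rpos_unitization_le andbC -andbA; congr (_ && _).
  apply/andP/idP => [[]//|zw]; split => //; apply: le_trans zw.
  apply/unitization_leP; split; rewrite /= ?subr0//.
  exists (tau 0); first exact: fixedp_trunc.
  rewrite -{1}[x]addr0 riesz_leDl riesz_scale_ge0//.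
  exact: trunc_ge0.
have -> : unitization_in (rpos x - unitization_cut (- l) (rpos x)) 0 =
    unitization_in (rpos x) 0 - unitization_in (unitization_cut (- l) (rpos x)) 0.
  by rewrite /unitization_in; congr pair; rewrite /= subr0.
rewrite unitization_sub_le le_unitization_cut ?rpos_ge0 ?oppr_ge0//.
rewrite 2!(unitization_sub_le _ w) subrr.
case: (boolP (0 <= w)) => //= w0.
have -> : unitization_in (rpos x) 0 - unitization_in 0 (- l) =
    unitization_in (rpos x) 0 + unitization_in 0 l.
  by rewrite /unitization_in; congr pair; rewrite /= ?oppr0 ?opprK.
have -> : ((x, l) : unitization tau) = unitization_in x 0 + unitization_in 0 l.
  by rewrite /unitization_in; congr pair; rewrite /= ?addr0 ?add0r.
set c := unitization_in 0 l.
rewrite -(subrK c w) !unitization_leDr rpos_unitization_le.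
suff -> : 0 <= w - c by [].
rewrite unitization_leE subr0 -unitization_leE; apply: le_trans w0.
rewrite unitization_leE; apply/unitization_coneP; split.
  by rewrite /= sub0r oppr_ge0.
exists (tau 0); first exact: fixedp_trunc.
by rewrite /= subrr oppr0 riesz_scale_ge0 ?trunc_ge0// sub0r oppr_ge0.
Qed.

Definition unitization_join z w := unitization_pos (z - w) + w.
Definition unitization_meet z w := - unitization_join (- z) (- w).

Lemma unitization_joinP z w t :
  (unitization_join z w <= t) = (z <= t) && (w <= t).
Proof.
rewrite /unitization_join -{1}(subrK w t) unitization_leDr unitization_posP.
by rewrite unitization_leDr unitization_ge0 -unitization_leE andbC.
Qed.

Lemma unitization_opp_le z w : (- z <= - w) = (w <= z).
Proof. by rewrite !unitization_leE opprK addrC. Qed.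

Lemma unitization_meetP t z w :
  (t <= unitization_meet z w) = (t <= z) && (t <= w).
Proof.
rewrite -{1}(opprK t) unitization_opp_le unitization_joinP.
by rewrite !unitization_opp_le.
Qed.

End Unitization_lattice.

HB.instance Definition _ (R : realType) (E : rieszType R) (tau : truncation E) :=
  isRiesz.Build R (unitization tau)
    (@unitization_meetP R E tau) (@unitization_joinP R E tau)
    (@unitization_leD R E tau) (@unitization_scale_ge0 R E tau).

HB.instance Definition _ (R : realType) (E : rieszType R) (tau : truncation E) :=
  Order.Lattice.copy (unitization tau)
    (Riesz.sort (unitization tau : rieszType R)).

Section Unitization_facts.
Variables (R : realType) (E : rieszType R) (tau : truncation E).

Lemma unitization_in_le (x y : E) :
  (unitization_in tau x 0 <= unitization_in tau y 0) = (x <= y).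
Proof.
rewrite unitization_leE /unitization_cone /= subrr eqxx ltxx /= orbF.
exact: riesz_subr_ge0.
Qed.

Lemma unitization_in_join (x y : E) :
  unitization_in tau (x `|` y) 0 = unitization_in tau x 0 `|` unitization_in tau y 0.
Proof.
apply/le_anti/andP; split; last by rewrite leUx !unitization_in_le leUl leUr.
set s := unitization_in tau x 0 `|` unitization_in tau y 0.
have : unitization_in tau x 0 <= s by exact: leUl.
have : unitization_in tau y 0 <= s by exact: leUr.
move=> /unitization_leP[/= s0 [g fg yg]] /unitization_leP[/= _ [h fh xh]].
apply/unitization_leP; split => //=; exists (g `|` h); first exact: fixedp_join.
rewrite subr0 in yg xh *.
rewrite leUx (le_trans xh) ?(le_trans yg)// riesz_leDl;
by rewrite riesz_le_scale ?leUl ?leUr.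
Qed.

Lemma unitization_truncE (x : E) : 0 <= x ->
  unitization_in tau (tau x) 0 = unitization_in tau x 0 `&` unitization_in tau 0 1.
Proof.
move=> x0; have -> : tau x = unitization_cut tau 1 x.
  by rewrite /unitization_cut invr1 !scale1r.
apply/le_anti/andP; split; last first.
  by rewrite le_unitization_cut// leIl leIr.
by rewrite lexI -le_unitization_cut.
Qed.

End Unitization_facts.

(* Main.v *)
Require Import Defs.
From mathcomp Require Import all_boot all_order all_algebra.
From mathcomp Require Import boolp classical_sets reals.
Import Order.TTheory GRing.Theory Num.Theory.
Local Open Scope order_scope.
Local Open Scope ring_scope.

(** If [u] is the truncation unit then the fixed points in the positive cone
    are exactly the [x] with [0 <= x <= u], so [x + l |-> (x + l u, l)] is an
    order isomorphism from the unitization onto the product [E * R] ordered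
    componentwise. Since [R] is Dedekind complete, suprema in the product exist
    as soon as they exist in [E]; conversely [E] is the kernel of the order
    preserving projection [x + l |-> l]. *)

(** The order asks for some fixed point [g] as a witness. Any such [g] is the meet of [g] and [u],
    so [g <= u], and [u] is itself fixed: [u] can always serve as the witness. *)
Lemma unital_unitization_leE {R : realType} {E : rieszType R}
    {tau : truncation E} {u : E} :
  0 <= u -> (forall x : E, 0 <= x -> tau x = x `&` u) ->
  forall z w : unitization tau,
  (z <= w) = (z.2 <= w.2) && (z.1 + z.2 *: u <= w.1 + w.2 *: u).
Proof.
move=> u0 tauE z w.
have shiftE : (z.1 <= w.1 + (w.2 - z.2) *: u) =
    (z.1 + z.2 *: u <= w.1 + w.2 *: u).
  by rewrite -(riesz_leDr (z.2 *: u)) -addrA -scalerDl subrK.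
apply/unitization_leP/andP => [[le2 [g [g0 gfix] le1]]|[le2 le1]]; split=> //.
  rewrite -shiftE (le_trans le1)// riesz_leDl riesz_le_scale ?subr_ge0//.
  by rewrite -gfix tauE// leIr.
by exists u; rewrite ?tauE ?meetxx// shiftE.
Qed.

Lemma dedekind_complete_unitization (R : realType) (E : rieszType R)
    (tau : truncation E) :
  unital_truncation tau -> dedekind_complete E ->
  dedekind_complete (unitization tau).
Proof.
move=> [u u0 tauE] compE A [[a Aa] [b Ab]].
have leE := unital_unitization_leE u0 tauE.
have ub_b z : A z -> (z.2 <= b.2) && (z.1 + z.2 *: u <= b.1 + b.2 *: u).
  by move=> /Ab; rewrite leE.
pose A1 : set E := [set z.1 + z.2 *: u | z in A]%classic.
pose A2 : set R := [set z.2 | z in A]%classic.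
have [s1 [ub1 lb1]] : exists s, supremums A1 s.
  apply: compE; split; first by exists (a.1 + a.2 *: u), a.
  by exists (b.1 + b.2 *: u) => _ [z /ub_b/andP[_ ?] <-].
have A2ne : (A2 !=set0)%classic by exists a.2, a.
have A2ub : has_ubound A2 by exists b.2 => _ [z /ub_b/andP[? _] <-].
(* This is the preimage of the componentwise supremum [(s1, sup A2)] under the shift by multiples of
   [u]. *)
exists (s1 - sup A2 *: u, sup A2); split=> [z Az|w Aw]; rewrite leE /= subrK.
  by rewrite ub_le_sup//=; [apply: ub1; exists z|exists z].
have ub_w z : A z -> (z.2 <= w.2) && (z.1 + z.2 *: u <= w.1 + w.2 *: u).
  by move=> /Aw; rewrite leE.
apply/andP; split.
  by apply: ge_sup => // _ [z /ub_w/andP[? _] <-].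
by apply: lb1 => _ [z /ub_w/andP[_ ?] <-].
Qed.

Lemma dedekind_complete_of_unitization (R : realType) (E : rieszType R)
    (tau : truncation E) :
  dedekind_complete (unitization tau) -> dedekind_complete E.
Proof.
move=> compU A [[a Aa] [b Ab]].
pose A' : set (unitization tau) := [set unitization_in tau x 0 | x in A]%classic.
have ub_in y : ubound A y -> ubound A' (unitization_in tau y 0).
  by move=> Ay _ [x Ax <-]; rewrite unitization_in_le Ay.
have [[s l] [ubs lbs]] : exists s, supremums A' s.
  apply: compU; split; first by exists (unitization_in tau a 0), a.
  by exists (unitization_in tau b 0); exact: ub_in.
(* The supremum lies in [E]: its scalar part is squeezed between those of [a], a member of [A], and
   of the upper bound [b], both zero. *)
have l0 : l = 0.
  apply/le_anti/andP; split.
    by have /unitization_leP[] := lbs _ (ub_in _ Ab).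
  by have /unitization_leP[] : unitization_in tau a 0 <= (s, l)
    by apply: ubs; exists a.
rewrite {}l0 in ubs lbs.
exists s; split=> [x Ax|y Ay]; rewrite -(unitization_in_le tau).
  by apply: ubs; exists x.
exact/lbs/ub_in.
Qed.

Theorem corollary5p6 (R : realType) (E : rieszType R) (tau : truncation E) :
  unital_truncation tau ->
  (dedekind_complete E <-> dedekind_complete (unitization tau)).
Proof.
move=> unital; split; first exact: dedekind_complete_unitization.
exact: dedekind_complete_of_unitization.
Qed.
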